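(* Let $0<q<p$ be real numbers and let $f,g,h\in\mathfrak{A}(p,q)$ have determining functions $A(t)$, $B(t)$ and $C(t)$, respectively. Then: 1. $f+g\in\mathfrak{A}(p,q)$ if $A(0)+B(0)\neq 0$; 2. $f+g$ has determining function $A(t)+B(t)$ (when $f+g$ is defined); 3. $f+(g+h)=(f+g)+h$ (when the sums involved are defined).
   Context: Polynomials have complex coefficients. Notation: $[n]_{p,q}=\frac{p^n-q^n}{p-q}$; $[0]_{p,q}!=1$ and $[n]_{p,q}!=\prod_{k=1}^n[k]_{p,q}$; $\binom{n}{2}=\frac{n(n-1)}{2}$; $e_{p,q}(z)=\sum_{n=0}^{\infty}\frac{p^{\binom n2}}{[n]_{p,q}!}z^n$; $D_{p,q}f(x)=\frac{f(px)-f(qx)}{(p-q)x}$ for $x\neq 0$, $(D_{p,q}f)(0)=f'(0)$. A polynomial set is a sequence $f=\{f_n(x)\}_{n\ge 0}$ with $f_n(x)$ of exact degree $n$. $\mathfrak{A}(p,q)$ is the class of all $(p,q)$-Appell sets, i.e. polynomial sets with $D_{p,q}f_{n+1}(x)=[n+1]_{p,q}f_n(px)$ for all $n\ge 0$. The determining function of $f\in\mathfrak{A}(p,q)$ is the (unique) formal power series $A(t)$ with $A(t)e_{p,q}(xt)=\sum_{n\ge0}f_n(x)\frac{t^n}{[n]_{p,q}!}$. The sum $f+g$ of two polynomial sets is the polynomial set whose $n$-th component is $f_n(x)+g_n(x)$; it is defined provided that $f_n(x)+g_n(x)$ has degree exactly $n$ for all $n$. *)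

(* Defs.v *)
From mathcomp Require Import all_boot all_order all_algebra.
From mathcomp Require Import reals.
From mathcomp Require Import complex.

Set Implicit Arguments.
Unset Strict Implicit.
Unset Printing Implicit Defensive.
Import Order.TTheory GRing.Theory Num.Theory.
Local Open Scope ring_scope.
Local Open Scope complex_scope.

Definition pqnum (R : realType) (p q : R) (n : nat) : R :=
  (p ^+ n - q ^+ n) / (p - q).

Definition pqfact (R : realType) (p q : R) (n : nat) : R :=
  \prod_(1 <= k < n.+1) pqnum p q k.

(* A formal power series over a ring S is its coefficient sequence nat -> S;
   sums of series are \+ and A(0) is the coefficient A 0%N. *)
Definition fps_mul (S : pzRingType) (a b : nat -> S) : nat -> S :=
  fun n => \sum_(i < n.+1) a i * b (n - i)%N.

Definition pqexp (R : realType) (p q : R) : nat -> R[i] :=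
  fun n => (p ^+ 'C(n, 2) / pqfact p q n)%:C.

(* For a series E(z), the series E(x t) in t, with coefficients in C[x]. *)
Definition fps_at_xt (R : realType) (E : nat -> R[i]) : nat -> {poly R[i]} :=
  fun n => E n *: 'X^n.

Definition pqderiv (R : realType) (p q : R) (f : {poly R[i]}) (x : R[i]) :
    R[i] :=
  if x == 0 then f^`().[0]
  else (f.[p%:C * x] - f.[q%:C * x]) / ((p%:C - q%:C) * x).

Record polyset (R : realType) := PolySet {
  pset :> nat -> {poly R[i]};
  size_pset : forall n, size (pset n) = n.+1
}.

(* Addition of polynomial sets is partial: it takes a proof that the sum is
   defined. *)
Definition psum_defined (R : realType) (f g : polyset R) : Prop :=
  forall n, size (f n + g n) = n.+1.

Definition psum (R : realType) (f g : polyset R) (fg : psum_defined f g) :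
    polyset R :=
  PolySet fg.

Definition pq_appell (R : realType) (p q : R) (f : polyset R) : Prop :=
  forall (n : nat) (x : R[i]),
    pqderiv p q (f n.+1) x = (pqnum p q n.+1)%:C * (f n).[p%:C * x].

(* A(t) e_{p,q}(x t) = \sum_n f_n(x) t^n / [n]_{p,q}! in C[x][[t]]. *)
Definition determining_function (R : realType) (p q : R) (f : polyset R)
    (A : nat -> R[i]) : Prop :=
  pq_appell p q f /\
  fps_mul (fun n => (A n)%:P) (fps_at_xt (pqexp p q))
    =1 (fun n => ((pqfact p q n)^-1)%:C *: f n).

Lemma determining_function_uniq (R : realType) (p q : R) (f : polyset R)
    (A B : nat -> R[i]) :
  determining_function p q f A -> determining_function p q f B -> A =1 B.
Proof.
have coef0 (D : nat -> R[i]) : determining_function p q f D ->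
    forall n, D n = (((pqfact p q n)^-1)%:C *: f n)`_0.
  case=> _ fD n; rewrite -fD /fps_mul coef_sum big_ord_recr /= big1 => [|i _].
    rewrite add0r subnn /fps_at_xt /pqexp /pqfact big_geq // expr0 divr1.
    by rewrite scale1r ?expr0 mulr1 coefC.
  rewrite coefCM /fps_at_xt coefZ coefXn eq_sym subn_eq0 leqNgt ltn_ord /=.
  by rewrite !mulr0.
by move=> fA fB n; rewrite (coef0 _ fA) (coef0 _ fB).
Qed.

(* Main.v *)
(** Comparing coefficients of [x^n t^n] in the defining identity shows that the
    leading coefficient of [f_n] is [A(0) p^binom(n,2)]. Hence that of
    [f_n + g_n] is [(A(0) + B(0)) p^binom(n,2)], and [f + g] is defined as soon
    as [A(0) + B(0) <> 0]. Everything else is linearity of [D_{p,q}] and of the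
    Cauchy product. *)
Require Import Defs.
From mathcomp Require Import all_boot all_order all_algebra.
From mathcomp Require Import boolp reals.
From mathcomp Require Import complex.
Import Order.TTheory GRing.Theory Num.Theory.
Local Open Scope ring_scope.
Local Open Scope complex_scope.

Lemma pqnum_gt0 (R : realType) (p q : R) (n : nat) :
  0 < q -> q < p -> (0 < n)%N -> 0 < pqnum p q n.
Proof.
move=> q_gt0 q_lt_p n_gt0; rewrite /pqnum divr_gt0 ?subr_gt0 //.
by rewrite ltrXn2r -?lt0n // ?ltW // (lt_trans q_gt0).
Qed.

Lemma pqfact_gt0 (R : realType) (p q : R) (n : nat) :
  0 < q -> q < p -> 0 < pqfact p q n.
Proof.
move=> q_gt0 q_lt_p; rewrite /pqfact big_nat; apply: prodr_gt0 => k.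
by case/andP=> k_gt0 _; apply: pqnum_gt0.
Qed.

(** The degree proof stored in a polynomial set is irrelevant. This is what lets associativity hold
    as an equality of records, although the two bracketings carry different degree proofs. *)
Lemma polyset_eq (R : realType) (f g : polyset R) : f =1 g -> f = g.
Proof.
(* Eliminating the equality of sequences gives both degree proofs the same type. *)
case: f g => [f sf] [g sg] /= /funext fg; case: g / fg sg => sg.
by congr PolySet; apply: Prop_irrelevance.
Qed.

Lemma fps_mulDl (S : pzRingType) (a b c : nat -> S) :
  fps_mul (a \+ b) c =1 fps_mul a c \+ fps_mul b c.
Proof.
move=> n; rewrite /fps_mul /= -big_split.
by apply: eq_bigr => i _; rewrite mulrDl.
Qed.

Lemma eq_fps_mull (S : pzRingType) (a b c : nat -> S) :
  a =1 b -> fps_mul a c =1 fps_mul b c.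
Proof. by move=> ab n; apply: eq_bigr => i _; rewrite ab. Qed.

(** The [i]-th term of the Cauchy product is a multiple of ['X^(n - i)], so only [i = 0] reaches
    degree [n]. *)
Lemma coef_fps_mul_at_xt (R : realType) (A E : nat -> R[i]) (n : nat) :
  (fps_mul (fun m => (A m)%:P) (fps_at_xt E) n)`_n = A 0%N * E n.
Proof.
rewrite /fps_mul coef_sum big_ord_recl /= big1 => [|i _].
  by rewrite subn0 addr0 coefCM coefZ coefXn eqxx mulr1.
rewrite coefCM coefZ coefXn /bump leq0n add1n.
(* Truncated subtraction is strict here: [i < n] forces [n] to be positive. *)
suff /negbTE-> : (n != n - i.+1)%N by rewrite !mulr0.
by rewrite neq_ltn ltn_subrL (leq_ltn_trans (leq0n i) (ltn_ord i)) orbT.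
Qed.

Lemma determining_function_coef (R : realType) (p q : R) (f : polyset R)
    (A : nat -> R[i]) (n : nat) : 0 < q -> q < p ->
  determining_function p q f A -> (f n)`_n = A 0%N * (p ^+ 'C(n, 2))%:C.
Proof.
move=> q_gt0 q_lt_p [_ /(_ n)/(congr1 (fun P : {poly R[i]} => P`_n))].
have F_neq0 : (pqfact p q n)%:C != 0.
  by rewrite fmorph_eq0 gt_eqF // pqfact_gt0.
rewrite coef_fps_mul_at_xt coefZ /pqexp rmorphM /= fmorphV mulrA.
(* The factor [1/[n]_{p,q}!] occurs both in the exponential series and in the expansion of [f], so
   it cancels. *)
by rewrite [RHS]mulrC => /(divIf F_neq0) <-.
Qed.

Lemma psum_defined_neq0 (R : realType) (p q : R) (f g : polyset R)
    (A B : nat -> R[i]) : 0 < q -> q < p ->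
  determining_function p q f A -> determining_function p q g B ->
  A 0%N + B 0%N <> 0 -> psum_defined f g.
Proof.
move=> q_gt0 q_lt_p detf detg /eqP AB n; apply/eqP; rewrite eqn_leq.
rewrite (leq_trans (size_polyD _ _)) ?size_pset ?maxnn //=.
(* A drop in degree would make the coefficient of ['X^n] vanish; as [p] is positive, this forces
   [A 0 + B 0 = 0]. *)
rewrite ltnNge; apply: contra AB => /leq_sizeP/(_ n (leqnn n)).
rewrite coefD (determining_function_coef _ _ _ _ _ _ q_gt0 q_lt_p detf).
rewrite (determining_function_coef _ _ _ _ _ _ q_gt0 q_lt_p detg) -mulrDl.
move/eqP; rewrite mulf_eq0 fmorph_eq0 => /orP[//|].
by rewrite gt_eqF // exprn_gt0 // (lt_trans q_gt0).
Qed.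

Lemma pqderivD (R : realType) (p q : R) (f g : {poly R[i]}) (x : R[i]) :
  pqderiv p q (f + g) x = pqderiv p q f x + pqderiv p q g x.
Proof.
rewrite /pqderiv derivD !hornerD; case: ifP => // _.
by rewrite -mulrDl opprD addrACA.
Qed.

Lemma pq_appell_psum (R : realType) (p q : R) (f g : polyset R)
    (fg : psum_defined f g) :
  pq_appell p q f -> pq_appell p q g -> pq_appell p q (psum fg).
Proof. by move=> fA gA n x; rewrite /= pqderivD fA gA hornerD mulrDr. Qed.

Lemma determining_function_psum (R : realType) (p q : R) (f g : polyset R)
    (A B : nat -> R[i]) (fg : psum_defined f g) :
  determining_function p q f A -> determining_function p q g B ->
  determining_function p q (psum fg) (A \+ B).
Proof.
move=> [fA detA] [gA detB]; split; first exact: pq_appell_psum.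
(* After factoring out the exponential series, only additivity of the embedding of constants into
   polynomials remains. *)
move=> n; rewrite /= scalerDr -detA -detB -[RHS]fps_mulDl.
by apply: eq_fps_mull => m; rewrite /= polyCD.
Qed.

Theorem theorem8 (R : realType) (p q : R) (q_gt0 : 0 < q) (q_lt_p : q < p)
    (f g h : polyset R)
    (fA : pq_appell p q f) (gA : pq_appell p q g) (hA : pq_appell p q h)
    (A B C : nat -> R[i])
    (detf : determining_function p q f A)
    (detg : determining_function p q g B)
    (deth : determining_function p q h C) :
  [/\ A 0%N + B 0%N <> 0 ->
        exists fg : psum_defined f g, pq_appell p q (psum fg),
      forall fg : psum_defined f g,
        determining_function p q (psum fg) (A \+ B)
    & forall (gh : psum_defined g h) (f_gh : psum_defined f (psum gh))
             (fg : psum_defined f g) (fg_h : psum_defined (psum fg) h),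
        psum f_gh = psum fg_h].
Proof.
split=> [AB|fg|gh f_gh fg fg_h].
- exists (psum_defined_neq0 _ _ _ _ _ _ _ q_gt0 q_lt_p detf detg AB).
  exact: pq_appell_psum.
- exact: determining_function_psum.
- by apply: polyset_eq => n /=; rewrite addrA.
Qed.
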